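(* There is an absolute constant $c>0$ such that the following holds. Let $F$ be a field of odd positive characteristic $p$, let $A\subset F$ be a finite set with $|A|>1$, and let $P=A\times A\subset F^2$. (a) If $|A|<p^{8/15}$, then $$|(A-A)^2+(A-A)^2|\ \ge\ c\,|A|^{9/8},$$ that is, $P$ defines at least $c\,|P|^{9/16}$ distinct quadratic distances. (b) If $|A|<p^{7/12}$, then $$|(A-A)^3+(A-A)^3|\ \ge\ c\,|A|^{36/35},$$ that is, $P$ defines at least $c\,|P|^{36/70}$ distinct cubic distances.
   Context: For a finite set $D\subset F$ and an integer $d$, $D^d=\{x^d: x\in D\}$; thus $(A-A)^d+(A-A)^d=\{(a-b)^d+(a'-b')^d: a,b,a',b'\in A\}$. The quadratic (respectively cubic) distance between $(x,y),(x',y')\in F^2$ is $(x-x')^2+(y-y')^2$ (respectively $(x-x')^3+(y-y')^3$). *)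

(* Defs.v *)
From mathcomp Require Import all_boot all_order all_algebra finmap.

Set Implicit Arguments.
Unset Strict Implicit.
Unset Printing Implicit Defensive.

Import GRing.Theory.
Local Open Scope fset_scope.
Local Open Scope ring_scope.

Section Sets.
Variable F : fieldType.
Implicit Types (A B D : {fset F}) (P : {fset F * F}).

Definition sumset A B : {fset F} := [fset a + b | a in A, b in B].

Definition diffset A B : {fset F} := [fset a - b | a in A, b in B].

Definition powset (d : nat) D : {fset F} := [fset x ^+ d | x in D].

Definition ddist (d : nat) (u v : F * F) : F :=
  (u.1 - v.1) ^+ d + (u.2 - v.2) ^+ d.

(* u = v is allowed, so 0 always counts as a distance when P is nonempty;
   with this convention ddists d (A `*` A) is exactly the sum set
   (A - A)^d + (A - A)^d. *)
Definition ddists (d : nat) P : {fset F} := [fset ddist d u v | u in P, v in P].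

End Sets.

(* Main.v *)
(* No incidence theorem is needed. Put S = (A - A)^d and suppose that S + S is
   small. By Petridis's form of the Pluennecke-Ruzsa inequality all sets
   jS - jS are small. Taking differences of squares, respectively second
   differences of cubes along a parallelogram in A, one finds k != 0 and a
   large B inside A (B = A for squares) such that jS - jS contains a translate
   of the dilate k x B for every x in D = B - B. Hence x B + y B is small for
   all x, y in D; counting collisions, the set Q of quotients D / D then has
   fewer than p elements. As Q contains 0, it is not closed under adding 1.
   Take xi = x / y in Q with xi + 1 not in Q. Then (b, b') |-> b + (xi + 1) b'
   is injective on B * B, although y B + x B + y B is small: a contradiction. *)
Require Import Defs.
From mathcomp Require Import all_boot all_order all_algebra finmap.
From mathcomp Require Import ring lra zify.
From mathcomp Require Import reals exp.

Set Implicit Arguments.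
Unset Strict Implicit.
Unset Printing Implicit Defensive.

Import Order.TTheory GRing.Theory Num.Theory.
Local Open Scope fset_scope.
Local Open Scope ring_scope.

(** * Cardinalities, fibers and collision counts *)

Section Counting.
Local Open Scope nat_scope.
Variables (T U : choiceType).

Lemma card_fsetM (A : {fset T}) (B : {fset U}) :
  #|` A `*` B| = #|` A| * #|` B|.
Proof.
rewrite -(size_allpairs pair A B); apply: perm_size; apply: uniq_perm.
- exact: fset_uniq.
- by apply: allpairs_uniq => // -[x y] [x' y'] _ _ /=.
move=> [x y]; rewrite in_fsetM /=; apply/andP/allpairsP => [[xA yB]|].
  by exists (x, y).
by case=> -[x' y'] /= [x'A y'B [-> ->]].
Qed.

Lemma leq_card_inj_in (f : T -> U) (A : {fset T}) (B : {fset U}) :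
  {in A &, injective f} -> {in A, forall x, f x \in B} -> #|` A| <= #|` B|.
Proof.
move=> injf fAB; rewrite -(card_in_imfset imfset_key injf) /=.
by apply/fsubset_leq_card/fsubsetP => _ /imfsetP[x xA ->]; apply: fAB.
Qed.

Lemma card_fibers (f : T -> U) (A : {fset T}) :
  #|` A| = \sum_(y <- [fset f x | x in A]) #|` [fset x in A | f x == y]|.
Proof.
rewrite card_fset_sum1 (partition_big_imfset _ f); apply: eq_bigr => y _.
by rewrite card_fset_sum1 big_fset.
Qed.

Lemma leq_card_fibers (f : T -> U) (A : {fset T}) (m : nat) :
  (forall y, #|` [fset x in A | f x == y]| <= m) ->
  #|` A| <= m * #|` [fset f x | x in A]|.
Proof.
move=> fib; rewrite (card_fibers f) (card_fset_sum1 [fset f x | x in A]).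
by rewrite big_distrr /=; apply: leq_sum => y _; rewrite muln1.
Qed.

Lemma pigeonhole_fiber (f : T -> U) (A : {fset T}) : A != fset0 ->
  exists2 y, y \in [fset f x | x in A] &
    #|` A| <= #|` [fset f x | x in A]| * #|` [fset x in A | f x == y]|.
Proof.
move=> /fset0Pn[x0 x0A]; set B := [fset f x | x in A]; set n := #|` A|.
pose r y := #|` [fset x in A | f x == y]|.
have k_gt0 : 0 < #|` B|.
  by rewrite cardfs_gt0; apply/fset0Pn; exists (f x0); apply/imfsetP; exists x0.
have n_gt0 : 0 < n by rewrite cardfs_gt0; apply/fset0Pn; exists x0.
suff: has (fun y => n <= #|` B| * r y) B by case/hasP => y yB ny; exists y.
apply/negPn/negP; rewrite -all_predC => /allP small.
have : \sum_(y <- B) #|` B| * r y <= \sum_(y <- B) n.-1.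
  rewrite big_seq [leqRHS]big_seq; apply: leq_sum => y /small /=.
  by rewrite -ltnNge -{1}(prednK n_gt0) ltnS.
rewrite -big_distrr /= -card_fibers -/n.
by rewrite big_const_seq count_predT iter_addn_0 mulnC leq_pmul2r //; lia.
Qed.

(** The double sum counts collisions of [f], that is, the sum of the squared fiber sizes.
    Cauchy-Schwarz then says that a small image forces many collisions. *)
Lemma collisions_lower_bound (f : T -> U) (A : {fset T}) :
  #|` A| ^ 2 <=
    #|` [fset f x | x in A]| * \sum_(x <- A) \sum_(y <- A) (f x == f y).
Proof.
set B := [fset f x | x in A]; pose r z := #|` [fset x in A | f x == z]|.
set m := #|` B|; set n := #|` A|.
have -> : \sum_(x <- A) \sum_(y <- A) (f x == f y) = \sum_(z <- B) r z ^ 2.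
  rewrite (partition_big_imfset _ f); apply: eq_bigr => z _.
  rewrite /r card_fset_sum1 big_fset /= expnS expn1 big_distrl /=.
  apply: eq_bigr => x /eqP ->; rewrite mul1n [RHS]big_mkcond /=.
  by apply: eq_bigr => y _; rewrite eq_sym; case: eqP.
have nE : n = \sum_(z <- B) r z by exact: card_fibers.
case: (posnP m) => [m0|m_gt0].
  move: m0 nE; rewrite /m => /eqP; rewrite cardfs_eq0 => /eqP ->.
  by rewrite big_seq_fset0 => ->.
(* Cauchy-Schwarz: sum over z of [2 m n r z <= (m r z)^2 + n^2]. *)
have : \sum_(z <- B) 2 * (m * r z * n) <= \sum_(z <- B) ((m * r z) ^ 2 + n ^ 2).
  by apply: leq_sum => z _; apply: nat_Cauchy.
have -> : \sum_(z <- B) 2 * (m * r z * n) = 2 * (m * n * n).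
  by rewrite -big_distrr /= -big_distrl -big_distrr /= -nE.
have -> : \sum_(z <- B) ((m * r z) ^ 2 + n ^ 2)
        = m * (m * \sum_(z <- B) r z ^ 2) + m * n ^ 2.
  rewrite big_split /=; congr (_ + _); last first.
    by rewrite /m [in RHS]card_fset_sum1 big_distrl /=; under [RHS]eq_bigr do rewrite mul1n.
  by rewrite mulnA big_distrr /=; apply: eq_bigr => z _; rewrite expnMn.
rewrite -(leq_pmul2l m_gt0) -mulnn; set e := \sum_(z <- B) _; nia.
Qed.

End Counting.

(** * Sum sets and the Pluennecke-Ruzsa inequality *)

Section Sumsets.
Variable F : fieldType.
Implicit Types A B C S X : {fset F}.

Lemma in_sumset A B x y : x \in A -> y \in B -> x + y \in sumset A B.
Proof. by move=> xA yB; apply: in_imfset2. Qed.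

Lemma sumsetP A B z :
  reflect (exists x y, [/\ x \in A, y \in B & z = x + y]) (z \in sumset A B).
Proof.
apply: (iffP (imfset2P _ _ _ _ _)) => [[x xA [y yB ->]]|[x [y [xA yB ->]]]].
  by exists x, y.
by exists x => //; exists y.
Qed.

Lemma in_diffset A B x y : x \in A -> y \in B -> x - y \in diffset A B.
Proof. by move=> xA yB; apply: in_imfset2. Qed.

Lemma diffsetP A B z :
  reflect (exists x y, [/\ x \in A, y \in B & z = x - y]) (z \in diffset A B).
Proof.
apply: (iffP (imfset2P _ _ _ _ _)) => [[x xA [y yB ->]]|[x [y [xA yB ->]]]].
  by exists x, y.
by exists x => //; exists y.
Qed.

Lemma sumsetC A B : sumset A B = sumset B A.
Proof.
by apply/fsetP => z; apply/sumsetP/sumsetP => -[x [y [xA yB ->]]];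
   exists y, x; rewrite addrC.
Qed.

Lemma sumsetA A B C : sumset A (sumset B C) = sumset (sumset A B) C.
Proof.
apply/fsetP => z; apply/sumsetP/sumsetP.
  case=> x [_ [xA /sumsetP[y [t [yB tC ->]]] ->]].
  by exists (x + y), t; rewrite in_sumset // addrA.
case=> _ [t [/sumsetP[x [y [xA yB ->]]] tC ->]].
by exists x, (y + t); rewrite in_sumset // addrA.
Qed.

Lemma sumset_subl A B C : A `<=` B -> sumset A C `<=` sumset B C.
Proof.
move=> /fsubsetP sAB; apply/fsubsetP => _ /sumsetP[x [y [xA yC ->]]].
by apply: in_sumset => //; apply: sAB.
Qed.

Definition itersum (j : nat) S : {fset F} := iter j (sumset S) [fset 0].

Lemma sumset0 S : sumset S [fset 0] = S.
Proof.
apply/fsetP => z; apply/sumsetP/idP => [[x [y [xS /fset1P -> ->]]]|zS].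
  by rewrite addr0.
by exists z, 0; rewrite fset11 addr0.
Qed.

Lemma itersum1 S : itersum 1 S = S.
Proof. exact: sumset0. Qed.

Lemma itersumD i j S : itersum (i + j) S = sumset (itersum i S) (itersum j S).
Proof.
elim: i => [|i IH]; first by rewrite sumsetC sumset0.
by rewrite addSn /= -/(itersum (i + j) S) IH sumsetA.
Qed.

Definition plusminus (j : nat) S : {fset F} :=
  diffset (itersum j S) (itersum j S).

Lemma in_plusminusD i j S x y :
  x \in plusminus i S -> y \in plusminus j S -> x + y \in plusminus (i + j) S.
Proof.
move=> /diffsetP[a [b [ai bi ->]]] /diffsetP[c [d [cj dj ->]]].
by rewrite addrACA -opprD; apply: in_diffset; rewrite itersumD in_sumset.
Qed.

(** [X] minimizes the ratio |Y + B| / |Y| over nonempty subsets Y of [A]. Cross-multiplied, this is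
    the hypothesis of [petridis], and it also covers empty Y. *)
Lemma exists_min_growth A B : A != fset0 ->
  exists X, [/\ X `<=` A, X != fset0 &
    forall Y, Y `<=` A -> (#|` sumset X B| * #|` Y| <= #|` sumset Y B| * #|` X|)%N].
Proof.
move=> A0.
have PA : A \in fpowerset A by rewrite fpowersetE fsubset_refl.
pose M (X : fpowerset A) : rat := #|` sumset (val X) B|%:R / #|` val X|%:R.
case: (@Order.TotalTheory.arg_minP _ _ _ [` PA] (fun X : fpowerset A => val X != fset0) M A0).
move=> X X0 minX; exists (val X); split => //.
  by rewrite -fpowersetE; apply: valP.
move=> Y YA; have [->|Y0] := eqVneq Y fset0; first by rewrite cardfs0 muln0.
have PY : Y \in fpowerset A by rewrite fpowersetE.
have := minX [` PY] Y0; rewrite /M /= ler_pdivrMr ?ltr0n ?cardfs_gt0 //.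
rewrite mulrAC ler_pdivlMr ?ltr0n ?cardfs_gt0 //.
by rewrite -!natrM ler_nat.
Qed.

Definition translate S (x : F) : {fset F} := [fset s + x | s in S].

Lemma card_translate S x : #|` translate S x| = #|` S|.
Proof. by rewrite card_imfset //=; apply: addIr. Qed.

Lemma translateP S x z :
  reflect (exists2 s, s \in S & z = s + x) (z \in translate S x).
Proof. exact: imfsetP. Qed.

Lemma sumset_fset0 A : sumset A fset0 = fset0.
Proof. by apply/fsetP => z; apply/sumsetP; rewrite in_fset0 => -[x [y []]]. Qed.

(* Petridis's lemma, by adding the elements of C one at a time. *)
Lemma petridis X B C :
  (forall Y, Y `<=` X -> (#|` sumset X B| * #|` Y| <= #|` sumset Y B| * #|` X|)%N) ->
  (#|` sumset (sumset X B) C| * #|` X| <= #|` sumset X B| * #|` sumset X C|)%N.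
Proof.
move=> minX; elim/fset1U_rect: C => [|c C _]; [|change {fset F} in (type of C) => IH].
  by rewrite !sumset_fset0 cardfs0.
(* [Z] is the part of [X] whose shift by [c] gives nothing new in X + C. *)
pose Z := [fset x in X | x + c \in sumset X C].
have ZX : Z `<=` X by apply/fsubsetP => x; rewrite !inE => /andP[].
have lower : (#|` sumset X C| + #|` X| <= #|` sumset X (c |` C)| + #|` Z|)%N.
  pose V := translate (X `\` Z) c.
  have disj : sumset X C `&` V = fset0.
    apply/fsetP => z; rewrite in_fset0 inE; apply/negbTE/negP => /andP[zXC].
    case/translateP => x; rewrite !inE => /andP[xZ xX] zE.
    by move: xZ; rewrite xX -zE zXC.
  have cU := cardfsUI (sumset X C) V; rewrite disj cardfs0 addn0 in cU.
  rewrite card_translate in cU.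
  have cD := cardfsID Z X; rewrite (fsetIidPr ZX) in cD.
  suff: (#|` sumset X C `|` V| <= #|` sumset X (c |` C)|)%N by lia.
  apply/fsubset_leq_card/fsubsetP => z.
  rewrite inE => /orP[/sumsetP[x [y [xX yC ->]]]|].
    by rewrite in_sumset // !inE yC orbT.
  case/translateP => x; rewrite !inE => /andP[_ xX] ->.
  by rewrite in_sumset // !inE eqxx.
(* The shift of Z + B by [c] already lies in X + B + C, so at most |X + B| - |Z + B| elements are
   added. *)
have upper : (#|` sumset (sumset X B) (c |` C)| + #|` sumset Z B|
   <= #|` sumset (sumset X B) C| + #|` sumset X B|)%N.
  have sub : translate (sumset Z B) c `<=` sumset (sumset X B) C.
    apply/fsubsetP => _ /translateP[_ /sumsetP[x [b [xZ bB ->]]] ->].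
    move: xZ; rewrite !inE => /andP[_ /sumsetP[x' [c' [x'X c'C E]]]].
    have -> : x + b + c = x' + b + c' by rewrite addrAC E addrAC.
    by rewrite !in_sumset.
  have ZXB := sumset_subl B ZX.
  have cD := cardfsID (sumset Z B) (sumset X B).
  rewrite (fsetIidPr ZXB) -(card_translate (_ `\` _) c) in cD.
  set V := translate (_ `\` _) _ in cD.
  have cU := (leq_card_fsetU (sumset (sumset X B) C) V).1.
  suff: (#|` sumset (sumset X B) (c |` C)| <=
         #|` sumset (sumset X B) C `|` V|)%N by lia.
  apply/fsubset_leq_card/fsubsetP => z /sumsetP[x [y [xXB]]].
  rewrite !inE => /orP[/eqP ->|yC] ->; last by rewrite in_sumset.
  have [xZB|xZB] := boolP (x \in sumset Z B).
    by rewrite (fsubsetP sub) //; apply/translateP; exists x.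
  by apply/orP; right; apply/translateP; exists x => //=; rewrite inE xZB.
(* Minimality of [X] against [Z] compares the two increments. *)
have := leq_mul upper (leqnn #|` X|); have := leq_mul (leqnn #|` sumset X B|) lower.
have := minX Z ZX; lia.
Qed.

(** Fix one representation d = b - c for each d in B - C. Then (x, d) maps to (x + b, x + c)
    injectively: the difference of the two coordinates recovers d, hence b, c and x. *)
Lemma ruzsa_triangle X B C :
  (#|` X| * #|` diffset B C| <= #|` sumset X B| * #|` sumset X C|)%N.
Proof.
rewrite -!card_fsetM.
have rep (d : F) : exists u : F * F,
    d \in diffset B C -> [/\ u.1 \in B, u.2 \in C & d = u.1 - u.2].
  have [/diffsetP[b [c [bB cC ->]]]|_] := boolP (d \in diffset B C).
    by exists (b, c).
  by exists (0, 0).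
have [g gP] : exists g : F -> F * F, {in diffset B C, forall d,
    [/\ (g d).1 \in B, (g d).2 \in C & d = (g d).1 - (g d).2]}.
  pose p d (u : F * F) := (d \in diffset B C) ==>
    [&& u.1 \in B, u.2 \in C & d == u.1 - u.2].
  have ex d : exists u, p d u.
    by have [u uP] := rep d; exists u; apply/implyP => /uP[-> -> /eqP].
  exists (fun d => xchoose (ex d)) => d dBC.
  by have /implyP/(_ dBC)/and3P[-> -> /eqP] := xchooseP (ex d).
pose f (v : F * F) := (v.1 + (g v.2).1, v.1 + (g v.2).2).
apply: (@leq_card_inj_in _ _ f) => [[x d] [x' d']|[x d]]; last first.
  rewrite !in_fsetM /= => /andP[xX dBC]; have [gB gC _] := gP d dBC.
  by rewrite !in_sumset.
rewrite !in_fsetM /= => /andP[xX dBC] /andP[x'X d'BC] [E1 E2].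
have dE : d = d'.
  have [_ _ ->] := gP d dBC; have [_ _ ->] := gP d' d'BC.
  rewrite (_ : (g d).1 - (g d).2 = (x + (g d).1) - (x + (g d).2)); last by ring.
  by rewrite E1 E2; ring.
by move: E1; rewrite dE => /addIr ->.
Qed.

(** With K = |S + S| / |S| this reads |jS - jS| <= K^(2j) |S|. Iterating Petridis's lemma on a
    minimizer [X] inside [S] gives |X + iS| <= K^i |X|; the Ruzsa triangle inequality through [X]
    with both sets equal to jS concludes. *)
Lemma plunnecke_ruzsa (S : {fset F}) (j : nat) : S != fset0 ->
  (#|` plusminus j S| * #|` S| ^ (j + j)
     <= #|` sumset S S| ^ (j + j) * #|` S|)%N.
Proof.
move=> S0; have [X [XS X0 minX]] := exists_min_growth S S0.
set s := #|` S|; set m := #|` sumset S S|.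
have x_gt0 : (0 < #|` X|)%N by rewrite cardfs_gt0.
have iterX i : (#|` sumset X (itersum i S)| * s ^ i <= m ^ i * #|` X|)%N.
  elim: i => [|i IH]; first by rewrite sumset0 muln1 mul1n.
  have := petridis (itersum i S) (fun Y YX => minX Y (fsubset_trans YX XS)).
  rewrite -sumsetA -[sumset S _]/(itersum i.+1 S) => step; have := minX S (fsubset_refl S).
  rewrite -/s -/m => base; rewrite -(leq_pmul2l x_gt0) -(leq_pmul2l x_gt0).
  rewrite !expnS; set P := (s ^ i)%N in IH *; set Q := (m ^ i)%N in IH *.
  apply: (@leq_trans (#|` X| * (#|` sumset X S| * s) *
                      (#|` sumset X (itersum i S)| * P))).
    by have := leq_mul (leqnn (#|` X| * s * P)) step; lia.
  by have := leq_mul (leqnn #|` X|) (leq_mul base IH); lia.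
rewrite -(leq_pmul2l x_gt0) !expnD.
have := leq_mul (ruzsa_triangle X (itersum j S) (itersum j S)) (leqnn (s ^ j * s ^ j)).
rewrite -/(plusminus j S) => H; apply: (@leq_trans (m ^ j * #|` X| * (m ^ j * #|` X|))).
  have := leq_mul (iterX j) (iterX j); lia.
have := leq_mul (leqnn (#|` X| * (m ^ j * m ^ j))) (fsubset_leq_card XS); lia.
Qed.

End Sumsets.

(** * Quotient sets and the pivot argument *)

Section Pivot.
Variable F : fieldType.
Implicit Types A B S W Q : {fset F}.

Definition pencil (xi : F) (u : F * F) : F := u.1 + xi * u.2.

(* Every pair u != v collides under pencil xi for at most one xi. *)
Lemma card_small_dilates B Q (M : nat) :
  (forall xi, xi \in Q ->
     #|` [fset pencil xi u | u in B `*` B]| <= M)%N ->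
  (#|` Q| * #|` B| ^ 2 <= M * (#|` Q| + #|` B| ^ 2))%N.
Proof.
move=> small; have [->|B0] := posnP #|` B|; first by rewrite muln0.
pose coll (xi : F) (u v : F * F) : nat := pencil xi u == pencil xi v.
have B2 : (#|` B `*` B| = #|` B| ^ 2)%N by rewrite card_fsetM.
set n := (#|` B| ^ 2)%N in B2 *; have n_gt0 : (0 < n)%N by rewrite expn_gt0 B0.
have many xi : xi \in Q ->
    (n ^ 2 <= M * \sum_(u <- B `*` B) \sum_(v <- B `*` B) coll xi u v)%N.
  move=> /small le_M; rewrite -B2.
  apply: leq_trans (collisions_lower_bound (pencil xi) _) _.
  by rewrite leq_mul2r le_M orbT.
(* Each diagonal pair collides for every [xi], giving n |Q| in total; each of the at most n^2 other
   pairs contributes at most 1. *)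
have few : (\sum_(xi <- Q) \sum_(u <- B `*` B) \sum_(v <- B `*` B) coll xi u v
    <= n * #|` Q| + n * n)%N.
  rewrite exchange_big /=; under eq_bigr do rewrite exchange_big /=.
  apply: (@leq_trans (\sum_(u <- B `*` B) (#|` Q| + n))); last first.
    by rewrite -mulnDr big_const_seq count_predT iter_addn_0 mulnC B2.
  rewrite big_seq [leqRHS]big_seq; apply: leq_sum => u uB.
  rewrite (big_fsetD1 u) //=; apply: leq_add.
    rewrite (card_fset_sum1 Q); apply: leq_sum => xi _; exact: leq_b1.
  apply: (@leq_trans #|` (B `*` B) `\ u|); last first.
    by rewrite -B2; apply/fsubset_leq_card/fsubD1set.
  rewrite card_fset_sum1 big_seq [leqRHS]big_seq; apply: leq_sum => v.
  rewrite in_fsetD1 => /andP[vu _].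
  have -> : (\sum_(xi <- Q) coll xi u v = count (fun xi => coll xi u v == 1) Q)%N.
    by rewrite -sumn_count sumnE big_map; apply: eq_bigr => xi _; rewrite /coll; case: eqP.
  rewrite -size_filter.
  (* Solving the collision equation for [xi] leaves this single value. *)
  apply: (@uniq_leq_size _ _ [:: (u.1 - v.1) / (v.2 - u.2)]).
    by rewrite filter_uniq // fset_uniq.
  move=> xi; rewrite mem_filter inE eqb1 => /andP[/eqP E _]; rewrite /pencil in E.
  have vu2 : v.2 - u.2 != 0.
    apply: contra vu; rewrite subr_eq0 => /eqP E2.
    by move: E; rewrite E2 => /addIr E1; rewrite [u]surjective_pairing
      [v]surjective_pairing E1 E2.
  apply/eqP; apply: (mulIf vu2); rewrite divfK //.
  have -> : xi * (v.2 - u.2) = (v.1 + xi * v.2) - xi * u.2 - v.1 by ring.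
  by rewrite -E; ring.
have : (#|` Q| * n ^ 2 <= M * (n * #|` Q| + n * n))%N.
  apply: leq_trans (leq_mul (leqnn M) few).
  rewrite (card_fset_sum1 Q) big_distrl big_distrr /= big_seq [leqRHS]big_seq.
  by apply: leq_sum => xi /many; rewrite mul1n.
rewrite -(leq_pmul2l n_gt0) -mulnn; nia.
Qed.

Lemma dilate_sums_growth (p : nat) B W (k : F) :
  p \in [pchar F] -> k != 0 -> (1 < #|` B|)%N ->
  (forall x, x \in diffset B B ->
     exists e, forall b, b \in B -> k * x * b + e \in W) ->
  (2 * #|` sumset W W| <= #|` B| ^ 2)%N -> (2 * #|` sumset W W| < p)%N ->
  (#|` B| ^ 2 <= #|` sumset (sumset W W) W|)%N.
Proof.
move=> pF k0 B1 lin small_B small_p.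
pose D := diffset B B; pose Q : {fset F} := [fset x / y | x in D, y in D].
have /fset0Pn[b bB] : B != fset0 by rewrite -cardfs_gt0; apply: ltn_trans B1.
have D0 : 0 \in D by rewrite -(subrr b) in_diffset.
have [y0 y0D y0_neq0] : exists2 y, y \in D & y != 0.
  have /fset0Pn[b'] : B `\ b != fset0.
    by rewrite -cardfs_gt0; have := cardfsD1 b B; rewrite bB; lia.
  rewrite in_fsetD1 => /andP[b'b b'B]; exists (b' - b); first exact: in_diffset.
  by rewrite subr_eq0.
have QP xi : xi \in Q -> exists x y, [/\ x \in D, y \in D, y != 0 & xi = x / y].
  (* A zero denominator yields x / 0 = 0, which is also the genuine quotient 0 / [y0]. *)
  case/imfset2P => x xD [y yD ->]; have [->|y_neq0] := eqVneq y 0.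
    by exists 0, y0; rewrite invr0 mulr0 mul0r.
  by exists x, y.
have Q0 : 0 \in Q by apply/imfset2P; exists 0 => //; exists y0; rewrite // mul0r.
(* With M = |W + W|, the bound |Q| |B|^2 <= M (|Q| + |B|^2) and 2M <= |B|^2 give |Q| <= 2M < p. *)
have card_Q : (#|` Q| < p)%N.
  have := @card_small_dilates B Q #|` sumset W W|.
  suff dilate xi : xi \in Q ->
      (#|` [fset pencil xi u | u in B `*` B]| <= #|` sumset W W|)%N.
    move=> /(_ dilate); nia.
  case/QP => x [y [xD yD y_neq0 ->]].
  have [ex exP] := lin x xD; have [ey eyP] := lin y yD.
  have ky : k * y != 0 by rewrite mulf_neq0.
  (* Scaling by [k * y] turns B + (x / y) B into kyB + kxB, a translate of which lies in W + W. *)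
  apply: (@leq_card_inj_in _ _ (fun z => k * y * z + (ey + ex))) => [z z' _ _|].
    by move/addIr/(mulfI ky).
  move=> _ /imfsetP[[b1 b2] /= + ->]; rewrite in_fsetM => /andP[b1B b2B].
  have -> : k * y * pencil (x / y) (b1, b2) + (ey + ex)
      = (k * y * b1 + ey) + (k * x * b2 + ex) by rewrite /pencil /=; field.
  by rewrite in_sumset ?eyP ?exP.
(* Otherwise [Q], containing 0, would contain the p distinct images of 0, ..., p - 1. *)
have [xi xiQ xi1Q] : exists2 xi, xi \in Q & xi + 1 \notin Q.
  suff: ~~ all (fun xi => xi + 1 \in Q) Q.
    by rewrite -has_predC => /hasP[xi]; exists xi.
  apply/negP => /allP closed; move: card_Q; rewrite ltnNge => /negP; apply.
  rewrite -{1}(size_iota 0 p) -(size_map (fun n => n%:R : F)).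
  apply: uniq_leq_size => [|_ /mapP[n _ ->]]; last first.
    elim: n => [|n IH]; first exact: Q0.
    by rewrite -addn1 natrD; apply: closed.
  rewrite map_inj_in_uniq ?iota_uniq // => m n.
  rewrite !mem_iota !add0n /=.
  wlog le_mn : m n / (m <= n)%N.
    by move=> wl mp np E; case/orP: (leq_total m n) => /wl-> //; rewrite E.
  move=> _ np /eqP; rewrite eq_sym -subr_eq0 -natrB // -(dvdn_pcharf pF).
  by move=> /dvdn_leq; lia.
have [x [y [xD yD y_neq0 xiE]]] := QP xi xiQ.
have [ex exP] := lin x xD; have [ey eyP] := lin y yD.
have -> : (#|` B| ^ 2 = #|` B `*` B|)%N by rewrite card_fsetM.
(* Up to a translation this is [k * y] times [pencil (xi + 1)]. A collision of distinct pairs would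
   write [xi + 1] as a quotient of two differences from [B]. *)
pose f (u : F * F) :=
  (k * y * u.1 + ey) + (k * x * u.2 + ex) + (k * y * u.2 + ey).
apply: (@leq_card_inj_in _ _ f) => [[b1 b2] [c1 c2]|[b1 b2]]; last first.
  by rewrite in_fsetM /f => /andP[/= b1B b2B]; rewrite !in_sumset ?eyP ?exP.
rewrite !in_fsetM /f /= => /andP[b1B b2B] /andP[c1B c2B] E.
have {}E : b1 - c1 = (xi + 1) * (c2 - b2).
  have ky : k * y != 0 by rewrite mulf_neq0.
  apply: (mulfI ky); apply/eqP; rewrite -subr_eq0; apply/eqP.
  rewrite -[RHS](subrr (k * y * c1 + ey + (k * x * c2 + ex) + (k * y * c2 + ey))).
  by rewrite -{1}E xiE; field.
have [E2|c2b2] := eqVneq c2 b2.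
  by move: E; rewrite E2 subrr mulr0 => /eqP; rewrite subr_eq0 => /eqP ->.
case/negP: xi1Q; apply/imfset2P; exists (b1 - c1); first exact: in_diffset.
exists (c2 - b2); first exact: in_diffset.
by rewrite E mulfK // subr_eq0.
Qed.
End Pivot.

(** * Linear forms inside differences of squares and of cubes *)

Section Growth.
Variable F : fieldType.
Implicit Types A B S : {fset F}.

(** For W = jS - jS, the sums W + W and W + W + W lie in 2jS - 2jS and 3jS - 3jS, whence the
    Pluennecke-Ruzsa exponents 4j and 6j. The two numerical hypotheses are those of
    [dilate_sums_growth] with denominators cleared. *)
Lemma sumset_growth (p j : nat) B S (k : F) :
  p \in [pchar F] -> k != 0 -> (1 < #|` B|)%N -> S != fset0 ->
  (forall x, x \in diffset B B ->
     exists e, forall b, b \in B -> k * x * b + e \in plusminus j S) ->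
  let s := #|` S| in let m := #|` sumset S S| in let n := #|` B| in
  (2 * (m ^ (4 * j) * s) <= n ^ 2 * s ^ (4 * j))%N ->
  (2 * (m ^ (4 * j) * s) < p * s ^ (4 * j))%N ->
  (n ^ 2 * s ^ (6 * j) <= m ^ (6 * j) * s)%N.
Proof.
move=> pF k0 B1 S0 lin s m n small_B small_p.
have s_gt0 : (0 < s)%N by rewrite cardfs_gt0.
pose W := plusminus j S.
have le2 : (#|` sumset W W| <= #|` plusminus (j + j) S|)%N.
  apply/fsubset_leq_card/fsubsetP => _ /sumsetP[x [y [xW yW ->]]].
  exact: in_plusminusD.
have le3 : (#|` sumset (sumset W W) W| <= #|` plusminus (j + j + j) S|)%N.
  apply/fsubset_leq_card/fsubsetP => _ /sumsetP[_ [z [/sumsetP[x [y [xW yW ->]]] zW ->]]].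
  by do 2!apply: in_plusminusD => //.
have PR2 := plunnecke_ruzsa (j + j) S0.
have PR3 := plunnecke_ruzsa (j + j + j) S0.
rewrite -/s -/m in PR2 PR3.
have e4 : (j + j + (j + j) = 4 * j)%N by lia.
have e6 : (j + j + j + (j + j + j) = 6 * j)%N by lia.
rewrite e4 in PR2; rewrite e6 in PR3.
have s4_gt0 : (0 < s ^ (4 * j))%N by rewrite expn_gt0 s_gt0.
have bound2 : (2 * #|` sumset W W| * s ^ (4 * j) <= 2 * (m ^ (4 * j) * s))%N.
  rewrite -mulnA leq_mul2l /=; apply: leq_trans PR2.
  by rewrite leq_mul2r le2 orbT.
apply: leq_trans PR3; rewrite leq_mul2r; apply/orP; right; apply: leq_trans le3.
apply: (dilate_sums_growth pF k0 B1 lin).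
  by rewrite -(leq_pmul2r s4_gt0); apply: leq_trans bound2 small_B.
by rewrite -(ltn_pmul2r s4_gt0); apply: leq_ltn_trans bound2 small_p.
Qed.

Lemma leq_card_diffset A : (#|` A| <= #|` diffset A A|)%N.
Proof.
have [->|/fset0Pn[b bA]] := eqVneq A fset0; first by rewrite cardfs0.
apply: (@leq_card_inj_in _ _ (fun a => a - b)) => [x y _ _ /addIr//|x xA].
exact: in_diffset.
Qed.

Lemma powsetP (d : nat) A y :
  reflect (exists2 x, x \in A & y = x ^+ d) (y \in powset d A).
Proof. exact: imfsetP. Qed.

(** A fiber of x |-> x^d consists of roots of X^d - y, so it has at most d elements. *)
Lemma leq_card_powset (d : nat) A :
  (0 < d)%N -> (#|` A| <= d * #|` powset d A|)%N.
Proof.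
move=> d_gt0; apply: leq_card_fibers => y.
set r := [fset x in A | _].
have sz : size ('X^d - y%:P : {poly F}) = d.+1 by rewrite size_XnsubC.
rewrite -ltnS -sz; apply: max_poly_roots; last exact: fset_uniq.
  by rewrite -size_poly_eq0 sz.
apply/allP => x; rewrite !inE => /andP[_ /eqP <-].
by rewrite rootE !hornerE subrr.
Qed.

Definition common_shift A (h : F) : {fset F} := [fset a in A | a + h \in A].

(** Pigeonhole on the differences of ordered pairs of distinct elements. Discarding the diagonal
    makes [h] nonzero and costs at most the factor 2, since |A| >= 2. *)
Lemma popular_difference A : (1 < #|` A|)%N ->
  exists2 h, h != 0 &
    (#|` A| ^ 2 <= 2 * (#|` diffset A A| * #|` common_shift A h|))%N.
Proof.
move=> A1; pose P := [fset u in A `*` A | u.1 != u.2].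
pose f (u : F * F) : F := u.2 - u.1.
have cP : (#|` A| ^ 2 <= 2 * #|` P|)%N.
  pose V := (A `*` A) `\` P.
  have VP u : u \in V -> u.1 = u.2 /\ u.1 \in A.
    rewrite in_fsetD !inE /= => /andP[+ /andP[u1 u2]].
    by rewrite u1 u2 /= negbK => /eqP.
  have : (#|` V| <= #|` A|)%N.
    apply: (@leq_card_inj_in _ _ fst) => [[x1 x2] [y1 y2]|u].
      by move=> /VP[/= -> _] /VP[/= -> _] ->.
    by case/VP.
  have PA : P `<=` A `*` A by apply/fsubsetP => u; rewrite inE => /andP[].
  have := cardfsID P (A `*` A); rewrite (fsetIidPr PA) card_fsetM -/V; nia.
have P0 : P != fset0 by rewrite -cardfs_gt0; nia.
have [h /imfsetP[u /= uP hE] hP] := pigeonhole_fiber f P0.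
exists h; first by move: uP; rewrite hE !inE subr_eq0 eq_sym => /andP[].
apply: leq_trans cP _; rewrite leq_mul2l /=; apply: leq_trans hP _.
apply: leq_mul.
  apply/fsubset_leq_card/fsubsetP => _ /imfsetP[v /= + ->].
  by rewrite !inE => /andP[/andP[v1 v2] _]; apply: in_diffset.
apply: (@leq_card_inj_in _ _ fst) => [[x1 x2] [y1 y2]|[x1 x2]]; rewrite !inE /f /=.
  by move=> /andP[_ /eqP E] /andP[_ /eqP E'] /= xy; move: E; rewrite -E' xy => /addIr ->.
by move=> /andP[/andP[/andP[x1A x2A] _] /eqP <-]; rewrite x1A addrC subrK.
Qed.

(** For x = a - d, the quadratic terms of (c - d)^2 - (c - a)^2 cancel, leaving slope 2x in c. *)
Lemma quadratic_linear_forms A x : x \in diffset A A ->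
  exists e, forall c, c \in A ->
    2 * x * c + e \in plusminus 1 (powset 2 (diffset A A)).
Proof.
case/diffsetP => a [d [aA dA ->]]; exists (d ^+ 2 - a ^+ 2) => c cA.
have -> : 2 * (a - d) * c + (d ^+ 2 - a ^+ 2) = (c - d) ^+ 2 - (c - a) ^+ 2 by ring.
by rewrite /plusminus itersum1 in_diffset //; apply/powsetP;
   [exists (c - d)|exists (c - a)]; rewrite ?in_diffset.
Qed.

(* The four cubes are taken at the corners of a parallelogram in A, so that
   their quadratic terms in c cancel. *)
Lemma cubic_linear_forms A h x :
  x \in diffset (common_shift A h) (common_shift A h) ->
  exists e, forall c, c \in common_shift A h ->
    6 * h * x * c + e \in plusminus 2 (powset 3 (diffset A A)).
Proof.
case/diffsetP => a [d []]; rewrite !inE => /andP[aA ahA] /andP[dA dhA] ->.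
(* The part free of [c] in the combination of four cubes below. *)
exists (- 6 * h * (a - d) * d - 3 * h * (a - d) * (h + (a - d))) => c.
rewrite !inE => /andP[cA _].
set e := (X in _ * c + X); have -> : 6 * h * (a - d) * c + e =
   ((c - d) ^+ 3 + (c - (a + h)) ^+ 3) - ((c - (d + h)) ^+ 3 + (c - a) ^+ 3).
  by rewrite /e; ring.
have pow z : z \in A -> (c - z) ^+ 3 \in powset 3 (diffset A A).
  by move=> zA; apply/powsetP; exists (c - z); rewrite ?in_diffset.
rewrite /plusminus (itersumD 1 1) itersum1.
by rewrite in_diffset ?in_sumset ?pow.
Qed.

Lemma ddists_product (d : nat) A :
  ddists d (A `*` A)
    = sumset (powset d (diffset A A)) (powset d (diffset A A)).
Proof.
apply/fsetP => z; apply/idP/sumsetP.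
  case/imfset2P => u /= uA [v /= vA ->]; rewrite !in_fsetM in uA vA.
  case/andP: uA vA => u1 u2 /andP[v1 v2].
  exists ((u.1 - v.1) ^+ d), ((u.2 - v.2) ^+ d); split => //; apply/powsetP;
    by [exists (u.1 - v.1); rewrite ?in_diffset|exists (u.2 - v.2); rewrite ?in_diffset].
case=> _ [_ [/powsetP[_ /diffsetP[a [b [aA bA ->]]] ->]
             /powsetP[_ /diffsetP[a' [b' [a'A b'A ->]]] ->] ->]].
by apply/imfset2P; exists (a, a'); [|exists (b, b')]; rewrite /= ?in_fsetM /= ?aA ?bA.
Qed.

End Growth.

(** * Inequalities that refute too small a sum set *)

Section Numerics.
Variable R : realFieldType.

(** Here t = |A|^(1/8), s = |S|, m = |S + S|, and the bound on [m] negates the claim. The first two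
    conclusions feed [sumset_growth] at j = 1; the third contradicts its conclusion. *)
Lemma quadratic_numerics (t s m p : R) :
  1 <= t -> 0 < m -> t ^+ 8 <= 2 * s -> m < t ^+ 9 / 6 -> t ^+ 15 < p ->
  [/\ 2 * (m ^+ 4 * s) <= (t ^+ 8) ^+ 2 * s ^+ 4,
      2 * (m ^+ 4 * s) < p * s ^+ 4 &
      m ^+ 6 * s < (t ^+ 8) ^+ 2 * s ^+ 6].
Proof.
move=> t1 m0 hs hm hp; have t0 : 0 < t by exact: lt_le_trans t1.
have hs' : t ^+ 8 / 2 <= s by lra.
have s0 : 0 < s by apply: lt_le_trans hs'; rewrite divr_gt0 ?exprn_gt0.
have tD a b : t ^+ a <= t ^+ (a + b) by rewrite ler_weXn2l ?leq_addr.
have tpos a : 0 < t ^+ a by rewrite exprn_gt0.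
have sX a : (t ^+ 8 / 2) ^+ a <= s ^+ a.
  by apply: lerXn2r hs'; rewrite nnegrE ltW // divr_gt0.
(* The denominator 2 matches that of the lower bound t^8 / 2 for [s]. *)
have hm' : m <= t ^+ 9 / 2 by have := tpos 9%N; lra.
have mX a : m ^+ a <= (t ^+ 9 / 2) ^+ a.
  by apply: lerXn2r hm'; rewrite nnegrE ltW // divr_gt0.
have s3 : t ^+ 24 / 8 <= s ^+ 3.
  by apply: le_trans (sX 3%N); rewrite [leRHS](_ : _ = t ^+ 24 / 8) //; field.
have s5 : t ^+ 40 / 32 <= s ^+ 5.
  by apply: le_trans (sX 5%N); rewrite [leRHS](_ : _ = t ^+ 40 / 32) //; field.
have m4 : m ^+ 4 <= t ^+ 36 / 16.
  by apply: le_trans (mX 4%N) _; rewrite [leLHS](_ : _ = t ^+ 36 / 16) //; field.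
have m6 : m ^+ 6 <= t ^+ 54 / 64.
  by apply: le_trans (mX 6%N) _; rewrite [leLHS](_ : _ = t ^+ 54 / 64) //; field.
split.
- rewrite mulrA [s ^+ 4]exprSr mulrA ler_pM2r // -exprM.
  apply: (@le_trans _ _ (t ^+ 16 * (t ^+ 24 / 8))); last by rewrite ler_pM2l.
  by rewrite mulrA -exprD; have := tD 36%N 4%N; have := tpos 36%N; lra.
- rewrite mulrA [s ^+ 4]exprSr mulrA ltr_pM2r //.
  apply: (@le_lt_trans _ _ (t ^+ 15 * (t ^+ 24 / 8))).
    by rewrite mulrA -exprD; have := tD 36%N 3%N; have := tpos 36%N; lra.
  apply: (@lt_le_trans _ _ (p * (t ^+ 24 / 8))); first by rewrite ltr_pM2r ?divr_gt0.
  by rewrite ler_pM2l // (lt_trans _ hp).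
rewrite [s ^+ 6]exprSr mulrA ltr_pM2r // -exprM.
apply: (@lt_le_trans _ _ (t ^+ 16 * (t ^+ 40 / 32))); last by rewrite ler_pM2l.
by rewrite mulrA -exprD; have := tD 54%N 2%N; have := tpos 54%N; lra.
Qed.

(** The same scheme at j = 2, with t = |A|^(1/35) and n the size of the popular common shift. *)
Lemma cubic_numerics (t n s m p : R) :
  1 <= t -> 0 < m -> 0 < n -> t ^+ 35 <= 3 * s -> (t ^+ 35) ^+ 2 <= 6 * m * n ->
  m < t ^+ 36 / 6 -> t ^+ 60 < p ->
  [/\ 1 < n, 2 * (m ^+ 8 * s) <= n ^+ 2 * s ^+ 8,
      2 * (m ^+ 8 * s) < p * s ^+ 8 &
      m ^+ 12 * s < n ^+ 2 * s ^+ 12].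
Proof.
move=> t1 m0 n0 hs hn hm hp; have t0 : 0 < t by exact: lt_le_trans t1.
have tD a b : t ^+ a <= t ^+ (a + b) by rewrite ler_weXn2l ?leq_addr.
have tpos a : 0 < t ^+ a by rewrite exprn_gt0.
pose u : R := 3^-1; have u0 : 0 < u by rewrite invr_gt0.
have upos a : 0 < u ^+ a by rewrite exprn_gt0.
have hs' : t ^+ 35 * u <= s by rewrite /u; lra.
have s0 : 0 < s by apply: lt_le_trans hs'; rewrite mulr_gt0.
have sX a : t ^+ (35 * a) * u ^+ a <= s ^+ a.
  by rewrite exprM -exprMn; apply: lerXn2r hs'; rewrite nnegrE ltW // mulr_gt0.
have hm' : m <= t ^+ 36 * u by have := tpos 36%N; rewrite /u; lra.
have mX a : m ^+ a <= t ^+ (36 * a) * u ^+ a.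
  by rewrite exprM -exprMn; apply: lerXn2r hm'; rewrite nnegrE ltW // mulr_gt0.
(* The constant 1/6 is chosen for this: t^70 <= 6 m n < t^36 n. *)
have hn' : t ^+ 34 < n.
  rewrite -(ltr_pM2l (tpos 36%N)) -exprD -[(36 + 34)%N]/(35 * 2)%N exprM.
  by apply: le_lt_trans hn _; rewrite ltr_pM2r //; lra.
have n1 : 1 < n by apply: le_lt_trans hn'; rewrite exprn_ege1.
have n2 : t ^+ 68 <= n ^+ 2.
  by rewrite (exprM t 34 2) lerXn2r ?nnegrE ?ltW.
have m8 : 2 * m ^+ 8 <= t ^+ 288 * u ^+ 7.
  have := mX 8%N; rewrite [u ^+ 8]exprSr -[(36 * 8)%N]/288%N.
  have := mulr_gt0 (tpos 288%N) (upos 7%N).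
  by rewrite mulrA; set w := _ * u ^+ 7; rewrite /u; lra.
have m12 : m ^+ 12 < t ^+ 432 * u ^+ 11.
  have := mX 12%N; rewrite [u ^+ 12]exprSr -[(36 * 12)%N]/432%N.
  have := mulr_gt0 (tpos 432%N) (upos 11%N).
  by rewrite mulrA; set w := _ * u ^+ 11; rewrite /u; lra.
split=> //.
- rewrite mulrA [s ^+ 8]exprSr mulrA ler_pM2r //; apply: le_trans m8 _.
  apply: le_trans (ler_pM (ltW (tpos 68%N)) _ n2 (sX 7%N)); last by rewrite mulr_ge0 ?ltW.
  by rewrite [leRHS]mulrA -exprD ler_pM2r ?(tD 288%N 25%N).
- rewrite mulrA [s ^+ 8]exprSr mulrA ltr_pM2r //; apply: le_lt_trans m8 _.
  apply: (@le_lt_trans _ _ (t ^+ 60 * (t ^+ 245 * u ^+ 7))).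
    by rewrite [leRHS]mulrA -exprD ler_pM2r ?(tD 288%N 17%N).
  apply: (@lt_le_trans _ _ (p * (t ^+ 245 * u ^+ 7))).
    by rewrite ltr_pM2r ?mulr_gt0.
  by rewrite ler_pM2l ?(sX 7%N) // (lt_trans _ hp).
rewrite [s ^+ 12]exprSr mulrA ltr_pM2r //; apply: lt_le_trans m12 _.
apply: le_trans (ler_pM (ltW (tpos 68%N)) _ n2 (sX 11%N)); last by rewrite mulr_ge0 ?ltW.
by rewrite [leRHS]mulrA -exprD ler_pM2r ?(tD 432%N 21%N).
Qed.
End Numerics.

(** * From real exponents to natural ones *)

Section Powers.
Variable R : realType.

(** Writing everything in terms of the k-th root [t] turns the fractional exponents into natural
    ones. *)
Lemma powR_root (N : R) (k : nat) : 1 <= N -> (0 < k)%N ->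
  exists t, [/\ 1 <= t, N = t ^+ k & forall a : nat, N `^ (a%:R / k%:R) = t ^+ a].
Proof.
move=> N1 k0; have N0 : 0 <= N by apply: le_trans N1.
have E a : N `^ (a%:R / k%:R) = (N `^ k%:R^-1) ^+ a.
  by rewrite mulrC powRrM powR_mulrn ?powR_ge0.
exists (N `^ k%:R^-1); split => //; last first.
  by rewrite -E divff ?powRr1 // pnatr_eq0 -lt0n.
by have := ler_powR N1 (_ : 0 <= k%:R^-1); rewrite powRr0; apply; rewrite invr_ge0.
Qed.

Lemma gt_powR_inv (N p e : R) : 0 <= N -> 0 <= p -> 0 < e ->
  N < p `^ e^-1 -> N `^ e < p.
Proof.
move=> N0 p0 e0 /(gt0_ltr_powR e0); rewrite !nnegrE N0 powR_ge0 => /(_ isT isT).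
by rewrite -powRrM mulVf ?gt_eqF // powRr1.
Qed.
End Powers.

(** * The growth bounds for squares and cubes *)

Section Main.
Variables (R : realType) (F : fieldType) (p : nat) (A : {fset F}).
Hypotheses (pF : p \in [pchar F]) (odd_p : odd p) (A1 : (1 < #|` A|)%N).

Let N1 : 1 <= #|` A|%:R :> R. Proof. by rewrite ler1n ltnW. Qed.

Let N0 : 0 <= #|` A|%:R :> R. Proof. exact: le_trans N1. Qed.

Lemma powset_diffset_neq0 d : powset d (diffset A A) != fset0.
Proof.
have /fset0Pn[a aA] : A != fset0 by rewrite -cardfs_gt0 ltnW.
apply/fset0Pn; exists ((a - a) ^+ d); apply/powsetP.
by exists (a - a); rewrite ?in_diffset.
Qed.

Lemma quadratic_growth :
  #|` A|%:R < p%:R `^ (8 / 15) :> R ->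
  6^-1 * #|` A|%:R `^ (9 / 8) <=
    #|` sumset (powset 2 (diffset A A)) (powset 2 (diffset A A))|%:R :> R.
Proof.
rewrite -(invf_div 15 8) => /(gt_powR_inv N0 (ler0n _ _)).
rewrite divr_gt0 // => /(_ isT) hp.
rewrite leNgt; apply/negP; rewrite mulrC => hm.
have hs : (#|` A| <= 2 * #|` powset 2 (diffset A A)|)%N.
  exact: leq_trans (leq_card_diffset A) (leq_card_powset _ _).
have S0 := powset_diffset_neq0 2.
set S := powset 2 _ in hm hs S0.
(* The slope factor 2 must be invertible; this is where [p] being odd enters. *)
have two0 : (2 : F) != 0.
  rewrite -(dvdn_pcharf pF); apply/negP => /dvdn_leq.
  by have := pcharf_prime pF; case: p odd_p => [|[|[|]]] // q _ _ /(_ isT).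
have := sumset_growth (B := A) (j := 1) pF two0 A1 S0 (@quadratic_linear_forms _ A).
have [t [t1 Nt Npow]] := powR_root N1 (isT : (0 < 8)%N).
rewrite Npow in hm; rewrite Npow in hp.
have m0 : 0 < #|` sumset S S|%:R :> R.
  have /fset0Pn[x xS] := S0; rewrite ltr0n cardfs_gt0.
  by apply/fset0Pn; exists (x + x); rewrite in_sumset.
have hs' : t ^+ 8 <= 2 * #|` S|%:R by rewrite -Nt -natrM ler_nat.
have [] := quadratic_numerics t1 m0 hs' hm hp.
rewrite -Nt -!natrX -!natrM !ler_nat !ltr_nat => h1 h2 h3.
by move=> /(_ h1 h2); rewrite leqNgt h3.
Qed.

Lemma cubic_growth :
  #|` A|%:R < p%:R `^ (7 / 12) :> R ->
  6^-1 * #|` A|%:R `^ (36 / 35) <=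
    #|` sumset (powset 3 (diffset A A)) (powset 3 (diffset A A))|%:R :> R.
Proof.
rewrite -(invf_div 12 7) => /(gt_powR_inv N0 (ler0n _ _)).
rewrite divr_gt0 // => /(_ isT) hp.
rewrite leNgt; apply/negP; rewrite mulrC => hm.
have hDS := leq_card_powset (diffset A A) (isT : (0 < 3)%N).
have hs := leq_trans (leq_card_diffset A) hDS.
have S0 := powset_diffset_neq0 3.
have [h h0 hA] := popular_difference A1.
have lin := @cubic_linear_forms _ A h.
set S := powset 3 _ in hm hs S0 hDS lin.
set B := common_shift A h in hA lin.
have [t [t1 Nt Npow]] := powR_root N1 (isT : (0 < 35)%N).
(* 12/7 is rewritten over 35 so that the bound on [p] becomes t^60 < p. *)
rewrite Npow in hm; move: hp; rewrite (_ : 12 / 7 = 60 / 35) ?Npow => [hp|]; last by field.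
have m0 : 0 < #|` sumset S S|%:R :> R.
  have /fset0Pn[x xS] := S0; rewrite ltr0n cardfs_gt0.
  by apply/fset0Pn; exists (x + x); rewrite in_sumset.
have hs' : t ^+ 35 <= 3 * #|` S|%:R by rewrite -Nt -natrM ler_nat.
have leSm : (#|` S| <= #|` sumset S S|)%N.
  have /fset0Pn[y yS] := S0.
  apply: (@leq_card_inj_in _ _ (fun x => x + y)) => [x x' _ _ /addIr//|x xS].
  exact: in_sumset.
(* |A|^2 <= 2 |A - A| |B|, with |A - A| <= 3 |S| and |S| <= |S + S|. *)
have hn : (t ^+ 35) ^+ 2 <= 6 * #|` sumset S S|%:R * #|` B|%:R.
  rewrite -Nt -natrX -!natrM ler_nat; apply: leq_trans hA _.
  rewrite mulnA leq_mul2r -[6%N]/(2 * 3)%N -mulnA leq_mul2l.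
  by rewrite (leq_trans hDS) ?orbT // leq_mul2l leSm.
have n0 : 0 < #|` B|%:R :> R.
  rewrite ltr0n lt0n; apply/eqP => B0; move: hn; rewrite B0 mulr0.
  by rewrite leNgt !exprn_gt0 // (lt_le_trans _ t1).
(* Were t^60 < 3, then 2 <= |A| = t^35 would give 2^12 <= t^420 < 3^7, which is false. So 3 <= t^60
   < p, and 6 is invertible in [F]. *)
have p_gt3 : (3 < p)%N.
  rewrite -(ltr_nat R); apply: le_lt_trans hp.
  rewrite leNgt; apply/negP => t60.
  have : (2 : R) ^+ 12 < 3 ^+ 7; last first.
    by rewrite -!natrX ltr_nat.
  apply: (@le_lt_trans _ _ (t ^+ 420)).
    rewrite (exprM t 35 12) -Nt; apply: lerXn2r; rewrite ?nnegrE ?ler0n //.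
    by rewrite ler_nat.
  rewrite (exprM t 60 7) ltrXn2r ?nnegrE ?exprn_ge0 ?ler0n //.
  exact: le_trans t1.
have six0 : (6 : F) != 0.
  rewrite -(dvdn_pcharf pF) -[6%N]/(2 * 3)%N Euclid_dvdM ?(pcharf_prime pF) // negb_or.
  by rewrite !gtnNdvd //; apply: ltn_trans p_gt3.
have [] := cubic_numerics t1 m0 n0 hs' hn hm hp.
rewrite -!natrX -!natrM !ler_nat !ltr_nat ltr1n => n1 h1 h2 h3.
have := sumset_growth (j := 2) pF (mulf_neq0 six0 h0) n1 S0 lin.
by move=> /(_ h1 h2); rewrite leqNgt h3.
Qed.
End Main.

Theorem corollary13 (R : realType) :
  exists c : R, 0 < c /\
  forall (F : fieldType) (p : nat) (A : {fset F}),
    p \in [pchar F] -> odd p -> (1 < #|` A|)%N ->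
    let P := A `*` A in
    (#|` A|%:R < p%:R `^ (8 / 15) :> R ->
       c * #|` A|%:R `^ (9 / 8)
         <= #|` sumset (powset 2 (diffset A A)) (powset 2 (diffset A A))|%:R
       /\ c * #|` P|%:R `^ (9 / 16) <= #|` ddists 2 P|%:R)
    /\
    (#|` A|%:R < p%:R `^ (7 / 12) :> R ->
       c * #|` A|%:R `^ (36 / 35)
         <= #|` sumset (powset 3 (diffset A A)) (powset 3 (diffset A A))|%:R
       /\ c * #|` P|%:R `^ (36 / 70) <= #|` ddists 3 P|%:R).
Proof.
exists 6^-1; split; first by rewrite invr_gt0.
move=> F p A pF odd_p A1 P.
have N0 : 0 <= #|` A|%:R :> R by [].
(* |P| = |A|^2, so the exponents 9/16 and 36/70 double to 9/8 and 36/35. *)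
have powP e : #|` P|%:R `^ e = #|` A|%:R `^ (2 * e) :> R.
  by rewrite /P card_fsetM mulnn natrX -powR_mulrn // -powRrM.
have e2 : 2 * (9 / 16) = 9 / 8 :> R by field.
have e3 : 2 * (36 / 70) = 36 / 35 :> R by field.
rewrite !ddists_product !powP e2 e3; split => hA.
  by have := quadratic_growth pF odd_p A1 hA.
by have := cubic_growth pF A1 hA.
Qed.
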